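(* For every complete graph $K_n$ of order $n$, the visibility polynomial is $\mathcal{V}(K_n)=(1+x)^n$.
   Context: Graphs are finite, simple and undirected. For a graph $G=(V,E)$ and $X\subseteq V$, two vertices $u,v$ are $X$-visible if there is a shortest $(u,v)$-path $P$ in $G$ with $V(P)\cap X\subseteq\{u,v\}$. A set $X\subseteq V$ is a mutual-visibility set of $G$ if every pair of vertices in $X$ is $X$-visible (the empty set counts as a mutual-visibility set). The visibility polynomial of $G$ is $\mathcal{V}(G)=\sum_{i\ge 0} r_i x^i$, where $r_i$ is the number of mutual-visibility sets of $G$ of cardinality $i$. $K_n$ is the graph on $n$ vertices in which any two distinct vertices are adjacent. *)

(* Defs.v *)
From mathcomp Require Import all_boot all_order all_algebra.
From mathcomp Require Import boolp.

Set Implicit Arguments.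
Unset Strict Implicit.
Unset Printing Implicit Defensive.

Import GRing.Theory.
Local Open Scope ring_scope.

Record sgraph := SGraph {
  vertex :> finType;
  adj : rel vertex;
  adj_sym : symmetric adj;
  adj_irrefl : irreflexive adj
}.

(* The path with vertex sequence u :: p; its length (number of edges) is
   size p. *)
Definition is_path (G : sgraph) (u v : G) (p : seq G) : Prop :=
  [/\ path (@adj G) u p, last u p = v & uniq (u :: p)].

Definition shortest_path (G : sgraph) (u v : G) (p : seq G) : Prop :=
  is_path u v p /\ forall q : seq G, is_path u v q -> (size p <= size q)%N.

Definition visible (G : sgraph) (X : {set G}) (u v : G) : Prop :=
  exists2 p : seq G, shortest_path u v p &
    [set w in u :: p] :&: X \subset [set u; v].

(* The diagonal pairs u = v are harmless: the one-vertex path makes u and u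
   always visible. *)
Definition mutual_visibility_set (G : sgraph) (X : {set G}) : Prop :=
  forall u v : G, u \in X -> v \in X -> visible X u v.

Definition num_mv_sets (G : sgraph) (i : nat) : nat :=
  #|[set X : {set G} | `[< mutual_visibility_set X >] & #|X| == i]|.

(* A set of vertices has at most #|G| elements, so the sum over all i >= 0
   stops at i = #|G|. *)
Definition visibility_poly (G : sgraph) : {poly int} :=
  \sum_(0 <= i < #|G|.+1) (num_mv_sets G i)%:R *: 'X^i.

Definition complete_graph (G : sgraph) : Prop :=
  forall u v : G, u != v -> adj u v.

(* Main.v *)
Require Import Defs.
From mathcomp Require Import all_boot all_order all_algebra.
From mathcomp Require Import boolp.
Local Open Scope ring_scope.

(** In a complete graph any two distinct vertices are joined by the path of
    length 1, which is shortest and has no inner vertex; so no set can obstruct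
    visibility ([complete_visible]) and every set of vertices is a
    mutual-visibility set. The mutual-visibility sets of cardinality [i] are
    therefore counted by the binomial coefficient ([complete_num_mv_sets]), and
    the visibility polynomial is the binomial expansion of [(1 + 'X) ^+ n]. *)

Lemma complete_visible (G : sgraph) (X : {set G}) (u v : G) :
  complete_graph G -> visible X u v.
Proof.
move=> hG; have [<-|neq_uv] := eqVneq u v.
  exists [::]; first by split.
  by apply/subsetP => w; rewrite !inE => /andP[->].
exists [:: v].
  split; first by split=> //=; rewrite ?inE ?neq_uv ?hG.
  (* The empty path would force u = v. *)
  by case=> [[_ /= eq_uv]|//]; rewrite eq_uv eqxx in neq_uv.
by apply/subsetP => w; rewrite !inE => /andP[].
Qed.

Lemma complete_num_mv_sets (G : sgraph) (i : nat) :
  complete_graph G -> num_mv_sets G i = 'C(#|G|, i).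
Proof.
move=> hG; rewrite /num_mv_sets -card_draws; apply: eq_card => X.
by rewrite !inE asboolT // => u v _ _; apply: complete_visible.
Qed.

Theorem theorem4 (n : nat) (G : sgraph) (hG : complete_graph G)
    (hn : #|G| = n) :
  visibility_poly G = (1 + 'X) ^+ n.
Proof.
rewrite /visibility_poly big_mkord hn GRing.addrC GRing.exprD1n.
by apply: eq_bigr => i _; rewrite complete_num_mv_sets // hn GRing.scaler_nat.
Qed.
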